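(* Let $G$ be a scheduling game belonging to one of the following classes: (i) games on related machines with arbitrary priority lists in which all jobs have the same processing-time function (either all $p(t)=b+at$, or all $p(t)=\max\{\tau,b-at\}$); (ii) games on two related machines with arbitrary priority lists in which all jobs have positive deterioration; (iii) games on identical machines (common speed $s$) with arbitrary priority lists in which either all jobs have positive deterioration or all jobs have negative deterioration with $a_i\le s$; (iv) games on related machines with a global priority list (all machines share the same list) and arbitrary jobs. Then every best-response sequence in $G$ is finite, and thus converges to a pure Nash equilibrium.
   Context: Scheduling game: a finite set $N$ of $n\ge1$ jobs (players) and a set $M$ of machines. Machine $j$ has speed $s_j>0$ and a priority list $\pi_j$, a bijection $N\to\{1,\dots,n\}$; job $u$ has higher priority than $v$ on $j$ iff $\pi_j(u)<\pi_j(v)$. Each job $i$ has a processing-time function $p_i$: with positive deterioration $p_i(t)=b_i+a_it$ ($b_i,a_i\ge0$), with negative deterioration $p_i(t)=\max\{\tau_i,b_i-a_it\}$ ($b_i,a_i\ge0$, $\tau_i>0$). A profile $\sigma\in M^N$ assigns each job to a machine. On machine $j$, the jobs assigned to it, listed in increasing $\pi_j$-order as $i_1,i_2,\dots$, are processed without idle time: $S_{i_1}(\sigma)=0$, $C_{i_k}(\sigma)=S_{i_k}(\sigma)+p_{i_k}(S_{i_k}(\sigma))/s_j$, $S_{i_{k+1}}(\sigma)=C_{i_k}(\sigma)$. The cost of job $i$ is $C_i(\sigma)$. A pure Nash equilibrium (NE) is a profile in which no job can strictly decrease its completion time by unilaterally changing its machine. A best-response sequence is a sequence of profiles in which each profile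 is obtained from the previous one by letting a single job, which can strictly decrease its completion time by deviating, move to a machine that minimizes its completion time given the other jobs' strategies. *)

(* Defs.v *)
From HB Require Import structures.
From mathcomp Require Import all_boot all_order all_algebra.
Set Implicit Arguments. Unset Strict Implicit. Unset Printing Implicit Defensive.
Import Order.TTheory GRing.Theory Num.Theory.
Local Open Scope ring_scope.

Inductive ptime (R : Type) := Pos of R & R | Neg of R & R & R.
Arguments Pos {R}. Arguments Neg {R}.

Definition ptime_eval (R : realDomainType) (q : ptime R) (t : R) : R :=
  match q with
  | Pos b a => b + a * t
  | Neg tau b a => Num.max tau (b - a * t)
  end.

Definition ptime_valid (R : realDomainType) (q : ptime R) : Prop :=
  match q with
  | Pos b a => 0 <= b /\ 0 <= a
  | Neg tau b a => 0 < tau /\ 0 <= b /\ 0 <= a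
  end.

Definition is_pos (R : Type) (q : ptime R) : bool :=
  if q is Pos _ _ then true else false.

Section Game.
Variables (R : realFieldType) (J M : finType).
Variables (speed : M -> R) (pi : M -> J -> 'I_#|J|) (p : J -> ptime R).

(* Processing the list l (in order) on a machine of speed s starting at time t;
   returns the completion time of job i (0 if i is not in l). *)
Fixpoint finish (s : R) (l : seq J) (t : R) (i : J) : R :=
  match l with
  | [::] => 0
  | u :: l' => let c := t + ptime_eval (p u) t / s in
               if i == u then c else finish s l' c i
  end.

(* jobs assigned to machine m, in increasing pi_m order (highest priority first) *)
Definition queue (sigma : {ffun J -> M}) (m : M) : seq J :=
  sort (fun u v => (pi m u <= pi m v)%N) [seq i <- enum J | sigma i == m].

Definition completion (sigma : {ffun J -> M}) (i : J) : R :=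
  finish (speed (sigma i)) (queue sigma (sigma i)) 0 i.

Definition deviate (sigma : {ffun J -> M}) (i : J) (m : M) : {ffun J -> M} :=
  [ffun k => if k == i then m else sigma k].

Definition is_NE (sigma : {ffun J -> M}) : Prop :=
  forall i m, completion sigma i <= completion (deviate sigma i m) i.

Definition br_step (sigma sigma' : {ffun J -> M}) : Prop :=
  exists i : J,
    (exists m, completion (deviate sigma i m) i < completion sigma i) /\
    exists m', sigma' = deviate sigma i m' /\
      forall m, completion (deviate sigma i m') i <= completion (deviate sigma i m) i.

End Game.

Definition class_i (R : realFieldType) (J : finType) (p : J -> ptime R) : Prop :=
  exists q : ptime R, forall i, p i = q.

Definition class_ii (R : realFieldType) (J M : finType) (p : J -> ptime R) : Prop :=
  #|M| = 2%N /\ forall i, is_pos (p i).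

Definition class_iii (R : realFieldType) (J M : finType) (speed : M -> R)
    (p : J -> ptime R) : Prop :=
  exists s : R, (forall m, speed m = s) /\
    ((forall i, is_pos (p i)) \/
     (forall i, exists tau b a, p i = Neg tau b a /\ a <= s)).

Definition class_iv (J M : finType) (pi : M -> J -> 'I_#|J|) : Prop :=
  forall m m', pi m = pi m'.

(* Main.v *)
Require Import Defs.
From HB Require Import structures.
From mathcomp Require Import all_boot all_order all_algebra.
From mathcomp Require Import lra.
Import Order.TTheory GRing.Theory Num.Theory.
Local Open Scope ring_scope.

Set Implicit Arguments. Unset Strict Implicit. Unset Printing Implicit Defensive.

(** An infinite improvement sequence on finitely many profiles yields a periodic
    one, in which a job that moves must later undo its move.  Each class of games
    provides a job for which this is impossible.
    - (i), (iii): among the moves reaching the least value (completion time in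
      (i), starting time in (iii)), take one whose job has top priority on its
      target machine.  A job overtaking it there would reach a value at least as
      small with a higher priority, so the mover keeps its value and stays.
    - (ii): take the mover of top priority on the slower machine, where its
      completion time is a constant K.  A job joining it there starts at K or
      later, hence started after K on the faster machine; its departure thus
      never makes the faster machine attractive.
    - (iv): the costs of the mover of top priority do not depend on the other
      movers, so its completion time can only decrease. *)

(** * Periodic sequences and comparison of folds *)

Lemma infinite_path_cycle (T : finType) (step : T -> T -> Prop) (f : nat -> T) :
  (forall k, step (f k) (f k.+1)) ->
  exists (h : nat -> T) (P : nat), [/\ (0 < P)%N,
    forall k, h (k + P)%N = h k & forall k, step (h k) (h k.+1)].
Proof.
move=> fstep.
have [a [b [lt_ab eq_ab]]] : exists a b, (a < b)%N /\ f a = f b.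
  have /injectivePn[x [y neq_xy eq_xy]] :
      ~~ injectiveb (fun i : 'I_#|T|.+1 => f i).
    by apply/injectiveP => /leq_card; rewrite card_ord ltnn.
  have := neq_xy; rewrite -val_eqE neq_ltn => /orP[] lt_xy.
    by exists x, y.
  by exists y, x.
have P_gt0 : (0 < b - a)%N by rewrite subn_gt0.
(* The segment from [a] to [b], repeated forever; only the wrap-around step needs [f a = f b]. *)
exists (fun k => f (a + k %% (b - a))%N), (b - a)%N; split=> // k.
  by rewrite modnDr.
have := fstep (a + k %% (b - a))%N; rewrite -addnS modnS.
case: ifP => // dvd_k; rewrite addn0.
suff -> : (k %% (b - a)).+1 = (b - a)%N by rewrite subnKC ?(ltnW lt_ab)// eq_ab.
apply/eqP; rewrite eqn_leq ltn_mod P_gt0 /=.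
apply: dvdn_leq => //; move: dvd_k.
by rewrite {1}(divn_eq k (b - a)) -addnS dvdn_addr // dvdn_mull.
Qed.

(** A kept element preserves the order by monotonicity; one kept only by [b] can only increase the
    larger side. *)
Lemma foldl_filter_le (R : realFieldType) (T : Type) (G : R -> T -> R)
    (l : seq T) (a b : pred T) (t t' : R) :
  (forall u x, 0 <= x -> x <= G x u) ->
  (forall u x y, 0 <= x -> x <= y -> G x u <= G y u) ->
  subpred a b -> 0 <= t -> t <= t' ->
  foldl G t (filter a l) <= foldl G t' (filter b l).
Proof.
move=> infl mono sub_ab; elim: l t t' => //= u l IHl t t' t_ge0 le_tt'.
have t'_ge0 := le_trans t_ge0 le_tt'.
case: (boolP (a u)) => [au|_].
  rewrite (sub_ab _ au) /=; apply: IHl; last exact: mono.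
  exact/(le_trans t_ge0)/infl.
case: (b u); last exact: IHl.
by apply: IHl => //; apply/(le_trans le_tt')/infl.
Qed.

(** * Completion times expressed through sets of preceding jobs *)

Section Cost.
Variables (R : realFieldType) (J M : finType).
Variables (speed : M -> R) (pi : M -> J -> 'I_#|J|) (p : J -> ptime R).
Hypothesis speed_gt0 : forall m, 0 < speed m.
Hypothesis pi_inj : forall m, injective (pi m).
Hypothesis p_valid : forall i, ptime_valid (p i).

Implicit Types (sigma : {ffun J -> M}) (m : M) (i u : J) (A B : {set J}).

Definition finish_from m u (t : R) : R := t + ptime_eval (p u) t / speed m.

Definition ahead sigma m i : {set J} :=
  [set u | (sigma u == m) && (pi m u < pi m i)%N].

(** Takes an arbitrary set rather than a profile, so that loads can be compared by inclusion. *)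
Definition load m A : R :=
  foldl (fun t u => finish_from m u t) 0
    [seq u <- sort (fun u v => (pi m u <= pi m v)%N) (enum J) | u \in A].

(** Since [ahead] never contains [i], this is the completion time of [i] on [m] whether or not [i]
    is currently there. *)
Definition cost sigma m i : R := finish_from m i (load m (ahead sigma m i)).

(** Injectivity of [pi m] makes the jobs before [i] in the list exactly those of strictly smaller
    rank. *)
Lemma finishE m (l : seq J) t i :
  sorted (fun u v => (pi m u <= pi m v)%N) l -> uniq l -> i \in l ->
  finish p (speed m) l t i =
  finish_from m i (foldl (fun t u => finish_from m u t) t
    [seq u <- l | (pi m u < pi m i)%N]).
Proof.
have leT_tr : transitive (fun u v => (pi m u <= pi m v)%N).
  by move=> y x z; apply: leq_trans.
elim: l t => //= u l IHl t; rewrite path_sortedE // => /andP[/allP u_min sl].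
case/andP=> u_l uniq_l; rewrite inE; case: (eqVneq i u) => [-> _|neq_iu /= i_l].
  rewrite ltnn (_ : filter _ l = [::]) //.
  apply/eqP; rewrite -[_ == _]negbK -has_filter -all_predC; apply/allP=> v v_l /=.
  by rewrite -leqNgt u_min.
rewrite (_ : (pi m u < pi m i)%N) /= ?IHl // ltn_neqAle u_min // andbT.
by apply: contra neq_iu => /eqP/val_inj/pi_inj ->.
Qed.

Lemma completion_deviate sigma i m :
  completion speed pi p (deviate sigma i m) i = cost sigma m i.
Proof.
rewrite /completion ffunE eqxx /queue.
have tot : total (fun u v => (pi m u <= pi m v)%N) by move=> x y; apply: leq_total.
have tr : transitive (fun u v => (pi m u <= pi m v)%N).
  by move=> y x z; apply: leq_trans.
rewrite finishE ?sort_sorted //; first last.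
- by rewrite mem_sort mem_filter mem_enum ffunE !eqxx.
- by rewrite sort_uniq; apply/filter_uniq/enum_uniq.
rewrite -(filter_sort tot tr) -filter_predI /cost /load.
congr (finish_from _ _ (foldl _ _ _)); apply: eq_filter => u /=.
by rewrite inE ffunE andbC; case: (eqVneq u i) => // ->; rewrite ltnn !andbF.
Qed.

Lemma deviate_id sigma i : deviate sigma i (sigma i) = sigma.
Proof. by apply/ffunP=> u; rewrite ffunE; case: eqP => // ->. Qed.

Lemma completionE sigma i : completion speed pi p sigma i = cost sigma (sigma i) i.
Proof. by rewrite -completion_deviate deviate_id. Qed.

Lemma no_br_step_NE sigma :
  (forall sigma', ~ br_step speed pi p sigma sigma') -> is_NE speed pi p sigma.
Proof.
move=> stuck i m; rewrite leNgt; apply/negP => lt_m.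
case: (arg_minP (i0 := m) (P := xpredT)
  (fun m => completion speed pi p (deviate sigma i m) i)) => // m' _ min_m'.
apply: (stuck (deviate sigma i m')); exists i; split; first by exists m.
by exists m'; split=> // m''; apply: min_m'.
Qed.

Lemma ptime_eval_ge0 i t : 0 <= t -> 0 <= ptime_eval (p i) t.
Proof.
move=> t_ge0; have := p_valid i; case: (p i) => [b a|tau b a] /=.
  by case=> b_ge0 a_ge0; rewrite addr_ge0 ?mulr_ge0.
by case=> tau_gt0 _; rewrite le_max ltW.
Qed.

Lemma finish_from_ge m u t : 0 <= t -> t <= finish_from m u t.
Proof. by move=> t_ge0; rewrite lerDl divr_ge0 ?ptime_eval_ge0 // ltW. Qed.

Lemma finish_from_le m u t t' :
  is_pos (p u) -> t <= t' -> finish_from m u t <= finish_from m u t'.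
Proof.
rewrite /finish_from; have := p_valid u; case: (p u) => //= b a [_ a_ge0] _ le_tt'.
rewrite lerD // ler_wpM2r ?invr_ge0 ?(ltW (speed_gt0 m)) //.
by rewrite lerD2l ler_wpM2l.
Qed.

(** Multiplied by the speed [s], the completion time is the maximum of [s * t + tau] and
    [b + (s - a) * t], both nondecreasing when [a <= s]. *)
Lemma finish_from_neg_le m u tau b a t t' :
  p u = Neg tau b a -> a <= speed m -> t <= t' ->
  finish_from m u t <= finish_from m u t'.
Proof.
move=> pu le_as le_tt'; rewrite /finish_from pu /=.
have s_gt0 := speed_gt0 m; have s_neq0 : speed m != 0 by rewrite gt_eqF.
rewrite -(ler_pM2r s_gt0) !mulrDl !divfK //.
have h : a * (t' - t) <= speed m * (t' - t) by rewrite ler_wpM2r // subr_ge0.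
have h' : 0 <= speed m * (t' - t) by rewrite mulr_ge0 ?subr_ge0 // ltW.
by rewrite -lerBrDl ge_max; apply/andP; split; rewrite lerBrDl;
  rewrite /Num.max; case: ltP => ?; nra.
Qed.

Lemma load_ge0 m A : 0 <= load m A.
Proof.
rewrite /load; elim/last_ind: (filter _ _) => //= l u IHl.
by rewrite foldl_rcons; apply/(le_trans IHl)/finish_from_ge.
Qed.

Lemma load_subset m A B :
  (forall u (t t' : R), 0 <= t -> t <= t' ->
     finish_from m u t <= finish_from m u t') ->
  A \subset B -> load m A <= load m B.
Proof.
move=> mono /subsetP sAB; apply: foldl_filter_le => // u t.
exact: finish_from_ge.
Qed.

(** The job [i] comes last in priority order, so the fold ends with it. *)
Lemma load_setU1 m A i :
  (forall v, v \in A -> (pi m v < pi m i)%N) ->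
  load m (i |: A) = finish_from m i (load m A).
Proof.
move=> A_lt; rewrite /load; set l := sort _ _.
suff -> : [seq u <- l | u \in i |: A] = rcons [seq u <- l | u \in A] i.
  by rewrite foldl_rcons.
have : sorted (fun u v => (pi m u <= pi m v)%N) l.
  by apply: sort_sorted => x y; apply: leq_total.
have : i \in l by rewrite mem_sort mem_enum.
have : uniq l by rewrite sort_uniq enum_uniq.
have leT_tr : transitive (fun u v => (pi m u <= pi m v)%N).
  by move=> y x z; apply: leq_trans.
elim: l => //= u l IHl /andP[u_l uniq_l].
rewrite inE path_sortedE // => i_ul /andP[/allP u_min sl].
case: (eqVneq i u) i_ul => [eq_iu _|neq_iu /= i_l]; last first.
  by rewrite !inE (negbTE (_ : u != i)) 1?eq_sym //= IHl //; case: ifP.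
have nA v : v \in u :: l -> v \notin A.
  rewrite inE => v_ul; apply/negP => /A_lt; rewrite ltnNge eq_iu.
  by case/predU1P: v_ul => [->|/u_min ->] //; rewrite leqnn.
rewrite !inE -eq_iu eqxx /= eq_iu (negbTE (nA u _)) ?mem_head //.
rewrite (eq_in_filter (a2 := pred0)) => [|v v_l /=].
  by rewrite (eq_in_filter (a2 := pred0)) ?filter_pred0 // => v v_l /=;
     rewrite (negbTE (nA v _)) // inE v_l orbT.
rewrite !inE (negbTE (nA v _)) ?inE ?v_l ?orbT // orbF.
by apply: contraNF u_l => /eqP <-.
Qed.

Lemma load_identical q m A :
  (forall u, p u = q) ->
  load m A = iter #|A| (fun t => t + ptime_eval q t / speed m) 0.
Proof.
move=> pq; rewrite /load.
have -> : #|A| = size [seq u <- sort (fun u v => (pi m u <= pi m v)%N) (enum J)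
                       | u \in A].
  rewrite cardE {1}/enum_mem !size_filter -enumT.
  by rewrite (permP (permEl (perm_sort _ _))).
elim/last_ind: (filter _ _) => //= l u IHl.
by rewrite foldl_rcons size_rcons iterS -IHl /finish_from pq.
Qed.

(** * Improving moves and their effect on the jobs ahead *)

Definition improving sigma u sigma' : bool :=
  (sigma' == deviate sigma u (sigma' u)) &&
  (cost sigma (sigma' u) u < cost sigma (sigma u) u).

Lemma br_step_improving sigma sigma' :
  br_step speed pi p sigma sigma' -> exists u, improving sigma u sigma'.
Proof.
case=> i [[m]]; rewrite (completionE sigma) => lt_m [m' [-> min_m']].
exists i; rewrite /improving !ffunE eqxx eqxx /= -completion_deviate.
exact: le_lt_trans (min_m' m) lt_m.
Qed.

Lemma improving_neq sigma u sigma' : improving sigma u sigma' -> sigma' u != sigma u.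
Proof. by case/andP=> _; apply: contraTneq => ->; rewrite ltxx. Qed.

Lemma improving_other sigma u sigma' v :
  improving sigma u sigma' -> v != u -> sigma' v = sigma v.
Proof. by case/andP=> /eqP -> _ /negbTE neq_vu; rewrite ffunE neq_vu. Qed.

Lemma ahead_subset sigma u sigma' m i :
  improving sigma u sigma' -> ~~ ((sigma' u == m) && (pi m u < pi m i)%N) ->
  ahead sigma' m i \subset ahead sigma m i.
Proof.
move=> imp not_ahead; apply/subsetP => v; rewrite !inE => /andP[v_m lt_vi].
case: (eqVneq v u) => [eq_vu|neq_vu]; last first.
  by rewrite -(improving_other imp neq_vu) v_m.
by rewrite -eq_vu v_m lt_vi in not_ahead.
Qed.

Lemma ahead_superset sigma u sigma' m i :
  improving sigma u sigma' -> ~~ ((sigma u == m) && (pi m u < pi m i)%N) ->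
  ahead sigma m i \subset ahead sigma' m i.
Proof.
move=> imp not_ahead; apply/subsetP => v; rewrite !inE => /andP[v_m lt_vi].
case: (eqVneq v u) => [eq_vu|neq_vu]; last first.
  by rewrite (improving_other imp neq_vu) v_m.
by rewrite -eq_vu v_m lt_vi in not_ahead.
Qed.

(** Applied to a job that no mover precedes on [m], this makes its cost on [m] constant along the
    sequence. *)
Lemma ahead_invariant sigma u sigma' m i :
  improving sigma u sigma' -> (pi m i <= pi m u)%N ->
  ahead sigma' m i = ahead sigma m i.
Proof.
move=> imp; rewrite leqNgt => /negbTE not_lt; apply/eqP; rewrite eqEsubset.
by rewrite (ahead_subset imp) ?(ahead_superset imp) // not_lt andbF.
Qed.

(** * Impossibility of periodic improvement sequences *)

Section Cycle.
Variables (h : nat -> {ffun J -> M}) (P : nat).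
Hypothesis P_gt0 : (0 < P)%N.
Hypothesis h_periodic : forall k, h (k + P)%N = h k.
Hypothesis h_step : forall k, exists u, improving (h k) u (h k.+1).

(** By periodicity, only the finitely many pairs of a step index modulo [P] and a job matter, so a
    minimum is attained. *)
Lemma cycle_min_step (disp : Order.disp_t) (T : orderType disp)
    (Q : {ffun J -> M} -> J -> {ffun J -> M} -> bool)
    (W : {ffun J -> M} -> J -> {ffun J -> M} -> T) k0 u0 :
  Q (h k0) u0 (h k0.+1) ->
  exists k i, Q (h k) i (h k.+1) /\ forall k' u, Q (h k') u (h k'.+1) ->
    (W (h k) i (h k.+1) <= W (h k') u (h k'.+1))%O.
Proof.
have hmod k : h (k %% P) = h k.
  rewrite {2}(divn_eq k P) addnC; elim: (k %/ P)%N => [|d IHd].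
    by rewrite addn0.
  by rewrite mulSn addnCA addnC h_periodic.
have hmodS k : h (k %% P).+1 = h k.+1.
  by rewrite -[LHS]hmod -[RHS]hmod -addn1 modnDml addn1.
pose x0 : 'I_P * J := (Ordinal (ltn_pmod k0 P_gt0), u0).
pose QQ (x : 'I_P * J) := Q (h x.1) x.2 (h x.1.+1).
move=> Q0; have Qx0 : QQ x0 by rewrite /QQ /= hmod hmodS.
case: (arg_minP (P := QQ) (fun x => W (h x.1) x.2 (h x.1.+1)) Qx0) => -[k i] Qki min.
exists (val k), i; split=> // k' u Qu.
have := min (Ordinal (ltn_pmod k' P_gt0), u); rewrite /QQ /= hmod hmodS; exact.
Qed.

(** Carries an invariant from just after step [k] around the period to index [k + P], whose profile
    is the one just before that step. *)
Lemma cycle_recurrence (I : nat -> Prop) k :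
  I k.+1 -> (forall k, I k -> I k.+1) -> I (k + P)%N.
Proof.
move=> Ik Istep; rewrite -(prednK P_gt0) addnS -addSn.
by elim: P.-1 => [|n IHn]; rewrite ?addn0 ?addnS //; apply: Istep.
Qed.

(** [V m A] abstracts the value of a position on [m] behind [A]; a cheaper position for a job must
    have a strictly smaller value. *)
Lemma no_cycle_of_value (V : M -> {set J} -> R) :
  (forall m A B, A \subset B -> V m A <= V m B) ->
  (forall u m m' A A',
     finish_from m' u (load m' A') < finish_from m u (load m A) ->
     V m' A' < V m A) ->
  False.
Proof.
move=> V_mono V_dec.
pose W sigma u (sigma' : {ffun J -> M}) := V (sigma' u) (ahead sigma (sigma' u) u).
have [u0 imp0] := h_step 0.
have [k0 [i0 [step0 minV]]] := cycle_min_step W imp0.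
set V0 := W _ _ _ in minV; pose m := h k0.+1 i0.
pose Q sigma u sigma' := [&& improving sigma u sigma', sigma' u == m
                           & W sigma u sigma' == V0].
have Q0 : Q (h k0) i0 (h k0.+1) by rewrite /Q step0 !eqxx.
have [k [i [/and3P[step_k /eqP to_m /eqP W_k] minP]]] :=
  cycle_min_step (fun _ u _ => pi m u : nat) Q0.
(* The chosen mover stays on its target, at a value no worse than the minimum. *)
pose I k := h k i = m /\ V m (ahead (h k) m i) <= V0.
have Ik : I k.+1.
  by split=> //; rewrite (ahead_invariant step_k) // -W_k /W to_m.
have [] : I (k + P)%N.
  apply: cycle_recurrence => // {Ik to_m W_k step_k} n [on_m le_V0].
  have [u imp] := h_step n; case: (eqVneq i u) => [eq_iu|neq_iu].
    (* A move of [i] itself would reach a value strictly below the minimum [V0]. *)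
    have := minV _ _ imp; rewrite leNgt => /negP[]; apply: lt_le_trans le_V0.
    rewrite -eq_iu; apply: (V_dec i); case/andP: imp => _.
    by rewrite -eq_iu /cost on_m.
  have on_m' : h n.+1 i = m by rewrite (improving_other imp).
  split=> //; case: (boolP ((h n.+1 u == m) && (pi m u < pi m i)%N)).
    case/andP=> /eqP u_m lt_ui.
    (* The jobs ahead of an overtaking [u] are also ahead of [i], so [u] attains [V0] with a higher
       priority, against the choice of [i]. *)
    have W_u : W (h n) u (h n.+1) = V0.
      apply/eqP; rewrite eq_le minV // andbT; apply: le_trans le_V0.
      rewrite /W u_m; apply: V_mono; apply/subsetP=> v.
      by rewrite !inE => /andP[-> /ltn_trans]; apply.
    have /minP : Q (h n) u (h n.+1) by rewrite /Q imp u_m W_u !eqxx.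
    by rewrite leEnat leqNgt lt_ui.
  by move/(ahead_subset imp)/(V_mono m)/le_trans; apply.
by rewrite h_periodic => hk _; have := improving_neq step_k; rewrite to_m hk eqxx.
Qed.

(** The completion time depends only on the number of jobs ahead. Its growth with that number
    follows from [t <= F m t]; [F m] may fail to be monotone under negative deterioration. *)
Lemma no_cycle_identical_jobs q : (forall u, p u = q) -> False.
Proof.
move=> pq; pose F m t := t + ptime_eval q t / speed m.
apply: (@no_cycle_of_value (fun m A => iter #|A|.+1 (F m) 0)).
  move=> m A B /subset_leq_card le_AB.
  (* Any job serves here: validity of [q] is inherited from it. *)
  have [u _] := h_step 0.
  have F_ge t : 0 <= t -> t <= F m t.
    by have := @finish_from_ge m u t; rewrite /finish_from pq.
  have it_ge0 n : 0 <= iter n (F m) 0.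
    by elim: n => //= n IHn; apply/(le_trans IHn)/F_ge.
  rewrite -(subnK le_AB) -addnS; elim: (#|B| - #|A|)%N => // n IHn.
  by rewrite addSn iterS; apply/(le_trans IHn)/F_ge.
by move=> u m m' A A'; rewrite /finish_from pq !(load_identical _ _ pq).
Qed.

(** With a common speed, the completion time is one nondecreasing function of the starting time, so
    finishing earlier forces starting earlier. *)
Lemma no_cycle_identical_machines :
  (forall m m', speed m = speed m') ->
  (forall m u (t t' : R), 0 <= t -> t <= t' ->
     finish_from m u t <= finish_from m u t') ->
  False.
Proof.
move=> eq_speed mono; apply: (@no_cycle_of_value load).
  by move=> m A B; apply: load_subset (mono m).
move=> u m m' A A'; rewrite {1}/finish_from (eq_speed m' m) !ltNge.
by apply: contra => le_load; apply: (mono m) => //; apply: load_ge0.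
Qed.

Lemma no_cycle_global_list : (forall m m', pi m = pi m') -> False.
Proof.
move=> eq_pi; have [u0 step0] := h_step 0; pose m0 := h 0%N u0.
have [k [i [step_k top]]] := cycle_min_step (fun _ u _ => pi m0 u : nat) step0.
have inv_cost n m : cost (h n) m i = cost (h 0) m i.
  elim: n => // n <-; have [u imp] := h_step n.
  by rewrite /cost (ahead_invariant imp) // (eq_pi m m0); apply: top imp.
have dec : cost (h 0) (h k.+1 i) i < cost (h 0) (h k i) i.
  by case/andP: step_k; rewrite !inv_cost.
have : cost (h 0) (h (k + P)%N i) i <= cost (h 0) (h k.+1 i) i.
  apply: (cycle_recurrence (I := fun n => cost (h 0) (h n i) i <= _)) => // n.
  apply: le_trans; have [u imp] := h_step n.
  case: (eqVneq i u) => [eq_iu|neq_iu]; last by rewrite (improving_other imp).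
  by case/andP: imp => _; rewrite -eq_iu !inv_cost => /ltW.
by rewrite h_periodic leNgt dec.
Qed.

Lemma no_cycle_two_machines m1 m2 :
  m1 != m2 -> (forall m, m = m1 \/ m = m2) -> speed m2 <= speed m1 ->
  (forall u, is_pos (p u)) -> False.
Proof.
move=> neq_m all_m le_speed p_pos; have [u0 step0] := h_step 0.
have [k [i [step_k top]]] := cycle_min_step (fun _ u _ => pi m2 u : nat) step0.
pose K := cost (h 0) m2 i.
have cost_m2 n : cost (h n) m2 i = K.
  rewrite /K; elim: n => // n <-; have [u imp] := h_step n.
  by rewrite /cost (ahead_invariant imp) //; apply: top imp.
have mono m A B : A \subset B -> load m A <= load m B.
  by apply: load_subset => u t t' _; apply: finish_from_le.
(* While [m1] offers at best [K], the job [i] has no reason to leave [m2]. *)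
pose stay n := h n i = m2 /\ K <= cost (h n) m1 i.
have stay_step n : stay n -> stay n.+1.
  case=> on_m2 le_K; have [u imp] := h_step n.
  have [_] := andP imp; case: (eqVneq i u) => [eq_iu|neq_iu].
    rewrite -eq_iu on_m2 cost_m2.
    have := improving_neq imp; rewrite -eq_iu on_m2.
    by case: (all_m (h n.+1 i)) => ->; rewrite ?eqxx // ltNge le_K.
  move=> lt_u; split; first by rewrite (improving_other imp).
  (* Only the departure from [m1] of a job ahead of [i] can lower the cost of [i] there. *)
  have [u_ahead|] := boolP ((h n u == m1) && (pi m1 u < pi m1 i)%N); last first.
    move/(ahead_superset imp)/mono => le_load.
    exact/(le_trans le_K)/finish_from_le.
  case/andP: u_ahead => /eqP u_m1 lt_ui.
  have u_m2 : h n.+1 u = m2.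
    by have := improving_neq imp; rewrite u_m1; case: (all_m (h n.+1 u)) => ->;
       rewrite ?eqxx.
  have lt_iu : (pi m2 i < pi m2 u)%N.
    rewrite ltn_neqAle; have /= := top _ _ imp; rewrite leEnat => ->; rewrite andbT.
    by apply: contra neq_iu => /eqP/val_inj/pi_inj ->.
  have K_le : K <= load m2 (ahead (h n) m2 u).
    rewrite -(cost_m2 n) /cost -load_setU1 => [|v]; last by rewrite inE => /andP[].
    apply: mono; apply/subsetP => v; rewrite !inE => /predU1P[->|/andP[-> lt_vi]].
      by rewrite on_m2 eqxx.
    exact: ltn_trans lt_vi lt_iu.
  (* Otherwise [u] would start on the faster [m1] no later than on [m2] and could not gain by
     leaving. *)
  have K_lt : K < load m1 (ahead (h n) m1 u).
    apply: le_lt_trans K_le _; rewrite ltNge; apply/negP => le_load.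
    move: lt_u; rewrite u_m1 u_m2 ltNge => /negP[]; rewrite /cost.
    apply: le_trans (finish_from_le _ (p_pos u) le_load) _.
    rewrite /finish_from lerD2l ler_wpM2l ?ptime_eval_ge0 ?load_ge0 //.
    by rewrite lef_pV2 ?posrE.
  (* The jobs that were ahead of [u] on [m1] remain ahead of [i], so [i] would start there after
     [K]. *)
  apply/ltW/(lt_le_trans K_lt)/le_trans/finish_from_ge/load_ge0.
  apply: mono; apply/subsetP => v; rewrite !inE => /andP[v_m1 lt_vu].
  rewrite (ltn_trans lt_vu) // (improving_other imp) ?v_m1 //.
  by apply: contraTneq lt_vu => ->; rewrite ltnn.
have [_ lt_i] := andP step_k.
case: (all_m (h k.+1 i)) => to_m.
  have from_m : h k i = m2.
    by have := improving_neq step_k; rewrite to_m; case: (all_m (h k i)) => ->;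
       rewrite ?eqxx.
  (* After moving to [m1], [i] either remains there or returns to [m2] by an improvement, which
     establishes [stay]. Both contradict its profitable move from [m2] to [m1] at step [k]. *)
  have [] : h (k + P)%N i = m1 \/ stay (k + P)%N.
  - apply: (cycle_recurrence (I := fun n => h n i = m1 \/ stay n)); first by left.
    move=> n [on_m1|/stay_step]; last by right.
    have [u imp] := h_step n; case: (eqVneq i u) => [eq_iu|neq_iu]; last first.
      by left; rewrite (improving_other imp).
    case: (all_m (h n.+1 i)) => to_n; [by left|right; split=> //].
    case/andP: (imp) => _; rewrite -eq_iu to_n on_m1 cost_m2 => /ltW.
    by rewrite /cost (ahead_invariant imp) // eq_iu.
  - by rewrite h_periodic from_m => eq_m; rewrite eq_m eqxx in neq_m.
  - case=> _; rewrite h_periodic leNgt; move: lt_i.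
    by rewrite to_m from_m cost_m2 => ->.
have [] : stay (k + P)%N.
  apply: cycle_recurrence => //; split=> //.
  move: lt_i; rewrite to_m cost_m2 => /ltW.
  have := improving_neq step_k; rewrite to_m.
  case: (all_m (h k i)) => ->; rewrite ?eqxx // => _.
  by rewrite /cost (ahead_invariant step_k).
rewrite h_periodic => hk _; have := improving_neq step_k.
by rewrite hk to_m eqxx.
Qed.

End Cycle.
End Cost.

Theorem theorem5 (R : realFieldType) (J M : finType)
    (speed : M -> R) (pi : M -> J -> 'I_#|J|) (p : J -> ptime R) :
  (0 < #|J|)%N ->
  (forall m, 0 < speed m) ->
  (forall m, bijective (pi m)) ->
  (forall i, ptime_valid (p i)) ->
  class_i p \/ class_ii M p \/ class_iii speed p \/ class_iv pi ->
  (~ exists f : nat -> {ffun J -> M},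
       forall k, br_step speed pi p (f k) (f k.+1)) /\
  (forall sigma, (forall sigma', ~ br_step speed pi p sigma sigma') ->
       is_NE speed pi p sigma).
Proof.
move=> _ speed_gt0 /(_ _)/bij_inj pi_inj p_valid classes.
split; last by move=> sigma; apply: no_br_step_NE.
case=> f /infinite_path_cycle[h [P [P_gt0 h_periodic h_br]]].
have h_step k : exists u, improving speed pi p (h k) u (h k.+1).
  exact: br_step_improving (h_br k).
case: classes => [[q pq]|[[card_M p_pos]|[[s [speed_s jobs]]|same_pi]]].
- by case: (no_cycle_identical_jobs speed_gt0 p_valid P_gt0 h_periodic h_step pq).
- have [m1 [m2 [neq_m all_m]]] :
      exists m1 m2 : M, m1 != m2 /\ forall m, m = m1 \/ m = m2.
    have /cards2P[m1 [m2 [neq_m eqT]]] : #|[set: M]| == 2%N.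
      by rewrite cardsT card_M.
    exists m1, m2; split=> // m; have := in_setT m.
    by rewrite eqT => /set2P.
  have [le_speed|/ltW le_speed] := leP (speed m2) (speed m1).
    by apply: (no_cycle_two_machines speed_gt0 pi_inj p_valid P_gt0 h_periodic
      h_step neq_m all_m).
  apply: (no_cycle_two_machines speed_gt0 pi_inj p_valid P_gt0 h_periodic h_step
           (m1 := m2) (m2 := m1)) => //; first by rewrite eq_sym.
  by move=> m; case: (all_m m); [right|left].
- apply: (no_cycle_identical_machines speed_gt0 p_valid P_gt0 h_periodic h_step).
    by move=> m m'; rewrite !speed_s.
  move=> m u t t' _; case: jobs => [p_pos|/(_ u)[tau [b [a [pu le_as]]]]].
    exact: finish_from_le.
  by apply: (finish_from_neg_le speed_gt0 pu); rewrite speed_s.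
- by case: (no_cycle_global_list P_gt0 h_periodic h_step same_pi).
Qed.
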